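(* Let $L$ be a planar semimodular lattice with more than one element. Then there is a sequence $$L_1, L_2, \dots, L_n = L$$ of lattices such that for each $i$ with $1 \leq i \leq n$, either $L_i$ is a patch lattice, or $L_i$ is the gluing over a chain of $L_j$ and $L_k$ for some $j, k < i$.
   Context: All planar lattices are finite. A planar lattice is a finite lattice having a planar Hasse diagram; such a diagram is fixed, and the left (resp. right) boundary of the lattice is the leftmost (resp. rightmost) maximal chain of this diagram. $0$ and $1$ denote the least and greatest elements, and $\prec$ denotes the covering relation. A lattice is semimodular if $a \wedge b \prec a$ implies $b \prec a \vee b$. An element is doubly-irreducible if it is both join-irreducible and meet-irreducible. A left weak corner (resp. right weak corner) of a planar lattice $L$ is a doubly-irreducible element of $L - \{0,1\}$ on the left (resp. right) boundary of $L$. A rectangular lattice is a planar semimodular lattice which has exactly one left weak corner, $u_l$, and exactly one right weak corner, $u_r$, and these are complementary: $u_l \vee u_r = 1$ and $u_l \wedge u_r = 0$. A patch lattice is either a rectangular lattice in which the weak corners $u_l$ and $u_r$ are dual atoms (elements covered by $1$), or the two-element chain. Gluing: a lattice $L$ is a gluing of the lattices $A$ and $B$ over $I$ if (up to isomorphism) $A$ is an ideal of $L$, $B$ is a filter of $L$, $L = A \cup B$, and $I = A \cap B \neq \varnothing$ (so $I$ is a filter of $A$ and an ideal of $B$). If $I$ is a chain, $L$ is said to be a gluing of $A$ and $B$ over a chain. *)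

(* Defs.v *)
From HB Require Import structures.
From mathcomp Require Import all_boot all_order all_algebra.
From mathcomp Require Import reals.

Set Implicit Arguments.
Unset Strict Implicit.
Unset Printing Implicit Defensive.

Import Order.TTheory GRing.Theory Num.Theory.

(* A nonempty finite lattice is a [finTBLatticeType]: 0 is [\bot], 1 is
   [\top], the meet and join are [`&`] and [`|`]. *)

Section LatticeNotions.
Local Open Scope order_scope.
Variables (d : Order.disp_t) (L : finTBLatticeType d).
Implicit Types (x y : L) (C S : {set L}).

Definition covered_by x y : bool := (x < y) && [forall z, ~~ (x < z < y)].

Definition semimodular : Prop :=
  forall a b : L, covered_by (a `&` b) a -> covered_by b (a `|` b).

Definition join_irreducible x : Prop :=
  x <> \bot /\ forall a b : L, x = a `|` b -> x = a \/ x = b.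

Definition meet_irreducible x : Prop :=
  x <> \top /\ forall a b : L, x = a `&` b -> x = a \/ x = b.

Definition doubly_irreducible x : Prop :=
  join_irreducible x /\ meet_irreducible x.

Definition dual_atom x : bool := covered_by x \top.

Definition is_chain C : bool := [forall x in C, forall y in C, x >=< y].

Definition maximal_chain C : bool := maxset is_chain C.

Definition is_ideal S : Prop :=
  [/\ S != set0,
      forall x y, x \in S -> y \in S -> x `|` y \in S
    & forall x y, y \in S -> x <= y -> x \in S].

Definition is_filter S : Prop :=
  [/\ S != set0,
      forall x y, x \in S -> y \in S -> x `&` y \in S
    & forall x y, x \in S -> x <= y -> y \in S].

End LatticeNotions.

Arguments semimodular {d} L.

Section Gluing.
Local Open Scope order_scope.

Definition lattice_embedding (d d' : Order.disp_t)
    (A : finTBLatticeType d) (L : finTBLatticeType d') (f : A -> L) : Prop :=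
  [/\ injective f,
      {morph f : x y / x `&` y >-> x `&` y}
    & {morph f : x y / x `|` y >-> x `|` y}].

(* "Up to isomorphism": A and B are identified with their images in L under
   embeddings f and g, which need not preserve both bounds. *)
Definition gluing (d dA dB : Order.disp_t) (L : finTBLatticeType d)
    (A : finTBLatticeType dA) (B : finTBLatticeType dB) (I : {set L}) : Prop :=
  exists (f : A -> L) (g : B -> L),
    [/\ lattice_embedding f /\ lattice_embedding g,
        is_ideal [set f x | x : A],
        is_filter [set g y | y : B],
        [set f x | x : A] :|: [set g y | y : B] = [set: L]
      & I = [set f x | x : A] :&: [set g y | y : B] /\ I != set0].

Definition gluing_over_chain (d dA dB : Order.disp_t) (L : finTBLatticeType d)
    (A : finTBLatticeType dA) (B : finTBLatticeType dB) : Prop :=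
  exists I : {set L}, gluing A B I /\ is_chain I.

End Gluing.

Section Diagrams.
Local Open Scope ring_scope.
Variables (R : realType) (d : Order.disp_t) (L : finTBLatticeType d).

(* [pos x] is the point of the plane R * R that represents x; the second
   coordinate is the height. *)
Implicit Types (pos : L -> R * R) (p q : R * R) (C : {set L}).

Definition on_edge pos (a b : L) p : Prop :=
  exists2 t : R, 0 <= t <= 1 &
    p = ((1 - t) * (pos a).1 + t * (pos b).1,
         (1 - t) * (pos a).2 + t * (pos b).2).

Definition hasse_diagram pos : Prop :=
  [/\ injective pos,
      forall a b : L, (a < b)%O -> (pos a).2 < (pos b).2
    & forall a b c : L, covered_by a b -> on_edge pos a b (pos c) ->
        c = a \/ c = b].

Definition planar_diagram pos : Prop :=
  hasse_diagram pos /\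
  forall (a b a' b' : L) (p : R * R),
    covered_by a b -> covered_by a' b' -> (a, b) <> (a', b') ->
    on_edge pos a b p -> on_edge pos a' b' p ->
    exists v : L, [/\ v = a \/ v = b, v = a' \/ v = b' & p = pos v].

Definition on_chain_line pos C p : Prop :=
  exists a b : L,
    [/\ a \in C, b \in C, covered_by a b & on_edge pos a b p].

(* All maximal chains run from 0 to 1, so their polygonal lines cross the same
   horizontal lines, each exactly once; they are compared at equal height. *)
Definition left_boundary pos C : Prop :=
  maximal_chain C /\
  forall (C' : {set L}) (p q : R * R), maximal_chain C' ->
    on_chain_line pos C p -> on_chain_line pos C' q -> p.2 = q.2 -> p.1 <= q.1.

Definition right_boundary pos C : Prop :=
  maximal_chain C /\
  forall (C' : {set L}) (p q : R * R), maximal_chain C' ->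
    on_chain_line pos C p -> on_chain_line pos C' q -> p.2 = q.2 -> q.1 <= p.1.

Definition left_weak_corner pos (u : L) : Prop :=
  [/\ u <> \bot%O, u <> \top%O, doubly_irreducible u
    & exists2 C : {set L}, left_boundary pos C & u \in C].

Definition right_weak_corner pos (u : L) : Prop :=
  [/\ u <> \bot%O, u <> \top%O, doubly_irreducible u
    & exists2 C : {set L}, right_boundary pos C & u \in C].

Definition rectangular_with pos (ul ur : L) : Prop :=
  [/\ planar_diagram pos, semimodular L,
      forall u : L, left_weak_corner pos u <-> u = ul,
      forall u : L, right_weak_corner pos u <-> u = ur
    & (ul `|` ur = \top)%O /\ (ul `&` ur = \bot)%O].

End Diagrams.

Definition planar (R : realType) (d : Order.disp_t)
    (L : finTBLatticeType d) : Prop :=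
  exists pos : L -> R * R, planar_diagram pos.

Definition patch_lattice (R : realType) (d : Order.disp_t)
    (L : finTBLatticeType d) : Prop :=
  (exists (pos : L -> R * R) (ul ur : L),
     [/\ rectangular_with pos ul ur, dual_atom ul & dual_atom ur])
  \/ #|L| = 2.

(* Main.v *)
(* Proof by induction on the size of [L]: it suffices to show that an
   indecomposable [L] (one that is not the union of a proper ideal [<= a] and a
   proper filter [>= b] with [[b, a]] a nonempty chain) is a patch lattice.

   Two maximal chains, drawn as graphs of functions of the height, can only
   cross at a common vertex. Let [e] be the leftmost dual atom. Crossing chains
   shows that the elements [x `&` e], for [x] not below [e], form a chain; let
   [b] be the least one and [x0] an upper cover of [b] not below [e]. By
   semimodularity every [y] in [[b, e]] is [(x0 `|` y) `&` e], so [[b, e]] is a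
   chain and [L] is the union of the ideal [<= e] and the filter [>= b]. Hence
   [b] is the bottom, the left boundary consists of the elements below [e] and
   the top, and [e] is its only weak corner, since [x0 `|` y] is a second upper
   cover of any other [y] there. The right side is symmetric. The meet of the
   two corners lies on both boundaries, so it is comparable to every element,
   and indecomposability makes it the bottom. *)
Require Import Defs.
From HB Require Import structures.
From mathcomp Require Import all_boot all_order all_algebra.
From mathcomp Require Import reals.
From mathcomp Require Import ring lra.

Set Implicit Arguments.
Unset Strict Implicit.
Unset Printing Implicit Defensive.

Import Order.TTheory GRing.Theory Num.Theory.

(** * Intervals as lattices, with the order and the diagram they inherit *)

Section IntervalLattice.
Local Open Scope order_scope.
Variables (d : Order.disp_t) (L : finTBLatticeType d).

(** The proof [ba] is part of the type so that instance inference can supply the bounds [b] and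
    [a]. *)
Definition interval_lattice (b a : L) (ba : b <= a) : Type :=
  {x : L | b <= x <= a}.

Variables (b a : L) (ba : b <= a).
Local Notation I := (interval_lattice ba).

HB.instance Definition _ := SubFinite.on I.
HB.instance Definition _ := [SubChoice_isSubPOrder of I by <: with d].

Fact interval_meet_closed :
  {in [pred x : L | b <= x <= a] &, forall u v, u `&` v \in [pred x : L | b <= x <= a]}.
Proof.
move=> x y /andP[bx xa] /andP[yb ya]; rewrite inE lexI bx yb /=.
exact: le_trans (leIl _ _) xa.
Qed.

Fact interval_join_closed :
  {in [pred x : L | b <= x <= a] &, forall u v, u `|` v \in [pred x : L | b <= x <= a]}.
Proof.
move=> x y /andP[bx xa] /andP[yb ya]; rewrite inE leUx xa ya.
by rewrite (le_trans bx (leUl _ _)).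
Qed.

HB.instance Definition _ :=
  Order.SubPOrder_isSubLattice.Build d L [pred x : L | b <= x <= a] d I
    interval_meet_closed interval_join_closed.

Fact interval_bot_subproof : b <= b <= a. Proof. by rewrite lexx. Qed.
Fact interval_top_subproof : b <= a <= a. Proof. by rewrite ba lexx. Qed.
Definition interval_bot : I := Sub b interval_bot_subproof.
Definition interval_top : I := Sub a interval_top_subproof.
Fact interval_le0x (x : I) : interval_bot <= x.
Proof. by rewrite -Order.le_val SubK; case/andP: (valP x). Qed.
Fact interval_lex1 (x : I) : x <= interval_top.
Proof. by rewrite -Order.le_val SubK; case/andP: (valP x). Qed.
HB.instance Definition _ := Order.hasBottom.Build d I interval_le0x.
HB.instance Definition _ := Order.hasTop.Build d I interval_lex1.

(** Intervals are convex, so an element of [L] separating two members of the interval is itself a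
    member. *)
Lemma interval_covered_by (x y : I) :
  covered_by x y = covered_by (val x) (val y).
Proof.
rewrite /covered_by -Order.SubPreorderTheory.lt_val; congr (_ && _).
apply/forallP/forallP => H z; last first.
  by have := H (val z); rewrite !Order.SubPreorderTheory.lt_val.
apply/negP => /andP[xz zy].
have zI : b <= z <= a.
  case/andP: (valP x) (valP y) => bx _ /andP[_ ya].
  by rewrite (le_trans bx (ltW xz)) (le_trans (ltW zy) ya).
by have := H (Sub z zI); rewrite -!Order.SubPreorderTheory.lt_val SubK xz zy.
Qed.

Lemma interval_semimodular : semimodular L -> semimodular (I : finTBLatticeType d).
Proof.
move=> sm x y; rewrite !interval_covered_by.
rewrite (_ : val (x `&` y) = val x `&` val y) //.
by rewrite (_ : val (x `|` y) = val x `|` val y) //; apply: sm.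
Qed.

Lemma interval_planar (R : realType) :
  planar R L -> planar R (I : finTBLatticeType d).
Proof.
case=> pos [[pos_inj pos_lt pos_edge] pos_cross]; exists (pos \o val).
split; first split.
- exact: inj_comp pos_inj val_inj.
- by move=> x y; rewrite -Order.SubPreorderTheory.lt_val; apply: pos_lt.
- move=> x y z; rewrite interval_covered_by => xy /(pos_edge _ _ _ xy).
  by case=> /val_inj; [left|right].
move=> x y x' y' p; rewrite !interval_covered_by => xy xy' ne px px'.
case: (pos_cross _ _ _ _ p xy xy' _ px px') => [[/val_inj ex /val_inj ey]|v].
  by apply: ne; rewrite ex ey.
(* The common vertex is an endpoint of both edges, hence already in the interval. *)
case=> vxy vxy' ->; case: vxy vxy' => -> [] /val_inj e.
- by exists x; split=> //; [left|left].
- by exists x; split=> //; [left|right].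
- by exists y; split=> //; [right|left].
- by exists y; split=> //; [right|right].
Qed.

Lemma interval_embedding : lattice_embedding (val : I -> L).
Proof. by split=> //; exact: val_inj. Qed.

Lemma interval_image : [set val x | x : I] = [set x | b <= x <= a].
Proof.
apply/setP=> x; rewrite inE; apply/imsetP/idP => [[y _ ->]|xI].
  exact: (valP y).
by exists (Sub x xI); rewrite ?SubK.
Qed.

Lemma card_interval : #|{: I}| = #|[set x | b <= x <= a]|.
Proof. by rewrite -interval_image card_imset //; exact: val_inj. Qed.

End IntervalLattice.

(** * Decompositions into an ideal and a filter meeting in a chain *)

Section Decomposition.
Local Open Scope order_scope.
Variables (d : Order.disp_t) (L : finTBLatticeType d).

(** The first two conditions make both pieces proper, as the induction requires. The notion is
    boolean so that a decomposing pair can be searched for. *)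
Definition chain_decomposition (b a : L) : bool :=
  [&& b != \bot, a != \top, b <= a, [forall x, (x <= a) || (b <= x)]
    & is_chain [set x | b <= x <= a]].

Lemma decomposition_gluing (b a : L) : chain_decomposition b a ->
  gluing_over_chain L (interval_lattice (le0x a)) (interval_lattice (lex1 b)).
Proof.
case/and5P=> b0 a1 ba /forallP cover chain.
exists [set x | b <= x <= a]; split=> //.
exists val, val; rewrite !interval_image; split.
- by split; apply: interval_embedding.
- split=> [|x y|x y]; rewrite ?inE ?le0x /=.
  + by apply/set0Pn; exists a; rewrite inE le0x lexx.
  + by rewrite leUx => -> ->.
  + by move=> ya xy; apply: le_trans xy ya.
- split=> [|x y|x y]; rewrite ?inE ?lex1 ?andbT.
  + by apply/set0Pn; exists b; rewrite inE lexx lex1.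
  + by rewrite lexI => -> ->.
  + by move=> bx xy; apply: le_trans bx xy.
- by apply/setP=> x; rewrite !inE le0x lex1 andbT /= cover.
- split; last by apply/set0Pn; exists b; rewrite inE lexx.
  by apply/setP=> x; rewrite !inE le0x lex1 andbT /= andbC.
Qed.

End Decomposition.

(** * Covers and maximal chains *)

Section MaximalChains.
Local Open Scope order_scope.
Variables (d : Order.disp_t) (L : finTBLatticeType d).
Implicit Types (e x y z : L) (C K : {set L}).

Lemma covered_byP x y : reflect
  (x < y /\ forall z, x < z -> z <= y -> z = y) (covered_by x y).
Proof.
apply: (iffP andP) => -[xy H]; split=> //.
  move=> z xz; rewrite le_eqVlt => /orP[/eqP //|zy].
  by move/forallP: H => /(_ z); rewrite xz zy.
apply/forallP => z; apply/negP => /andP[xz zy].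
by move: (zy); rewrite (H z xz (ltW zy)) ltxx.
Qed.

Lemma covered_by_lt x y : covered_by x y -> x < y.
Proof. by case/andP. Qed.

(** Among the elements above [x] and at most [y], one with the fewest elements below it works. *)
Lemma covered_by_exists x y : x < y -> exists2 z, covered_by x z & z <= y.
Proof.
move=> xy; case: (arg_minnP (fun z => #|[set u | u < z]|)
  (P := fun z => x < z <= y) (i0 := y)) => [|z /andP[xz zy] minz].
  by rewrite xy lexx.
exists z => //; apply/covered_byP; split=> // w xw.
rewrite le_eqVlt => /orP[/eqP //|wz].
have /minz : x < w <= y by rewrite xw (le_trans (ltW wz)).
rewrite leqNgt proper_card //; apply/properP; split.
  by apply/subsetP => u; rewrite !inE => /lt_trans; apply.
by exists w; rewrite !inE ?ltxx.
Qed.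

Lemma dual_atom_le e x : dual_atom e -> e <= x -> x = e \/ x = \top.
Proof.
case/covered_byP => e1 H; rewrite le_eqVlt => /orP[/eqP|ex]; first by left.
by right; apply: H => //; exact: lex1.
Qed.

Lemma dual_atom_neq_top e : dual_atom e -> e != \top.
Proof. by move/covered_by_lt; rewrite lt_neqAle => /andP[]. Qed.

Lemma chain_cmp C x y : is_chain C -> x \in C -> y \in C -> x >=< y.
Proof. by move/forall_inP => H xC yC; move/forall_inP: (H x xC) => ->. Qed.

Lemma chainP C : (forall x y, x \in C -> y \in C -> x >=< y) -> is_chain C.
Proof.
by move=> H; apply/forall_inP => x xC; apply/forall_inP => y yC; exact: H.
Qed.

Lemma maximal_chain_cmp C x y :
  maximal_chain C -> x \in C -> y \in C -> x >=< y.
Proof. by case/maxsetP => CC _; exact: chain_cmp. Qed.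

Lemma maximal_chain_mem C x :
  maximal_chain C -> (forall y, y \in C -> x >=< y) -> x \in C.
Proof.
case/maxsetP => CC max H; rewrite -(max (x |: C)) ?setU11 ?subsetUr //.
apply: chainP => y z; rewrite !inE.
case/orP => [/eqP ->|yC] /orP[/eqP ->|zC]; rewrite ?comparablexx ?H //.
  by rewrite comparable_sym H.
exact: chain_cmp zC.
Qed.

Lemma maximal_chain_top C : maximal_chain C -> \top \in C.
Proof.
by move=> CC; apply: maximal_chain_mem => // y _; rewrite /Order.comparable lex1 orbT.
Qed.

Lemma maximal_chain_bot C : maximal_chain C -> \bot \in C.
Proof.
by move=> CC; apply: maximal_chain_mem => // y _; rewrite /Order.comparable le0x.
Qed.

Lemma maximal_chain_eq C C' :
  maximal_chain C -> maximal_chain C' -> C' \subset C -> C = C'.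
Proof. by case/maxsetP => CC _ /maxsetP[_]; apply. Qed.

Lemma maximal_chain_through x y : x <= y ->
  exists C, [/\ maximal_chain C, x \in C & y \in C].
Proof.
move=> xy; case: (@maxset_exists _ (@is_chain d L) [set x; y]) => [|C CC].
  by apply: chainP => u v; rewrite !inE => /orP[] /eqP -> /orP[] /eqP ->;
     rewrite ?comparablexx // /Order.comparable xy ?orbT.
move/subsetP => sub.
by exists C; split=> //; apply: sub; rewrite !inE eqxx ?orbT.
Qed.

(** An element strictly between the two neighbours would be comparable to all of [C], hence a member
    of it. *)
Lemma chain_covered_by C x y : maximal_chain C -> x \in C -> y \in C -> x < y ->
  (forall z, z \in C -> (z <= x) || (y <= z)) -> covered_by x y.
Proof.
move=> CC xC yC xy H; apply/covered_byP; split=> // z xz zy.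
have zC : z \in C.
  apply: maximal_chain_mem => // w /H /orP[wx|yw].
    by rewrite /Order.comparable (le_trans wx (ltW xz)) orbT.
  by rewrite /Order.comparable (le_trans zy yw).
case/orP: (H z zC) => [zx|yz]; last by apply/le_anti; rewrite zy yz.
by move: (lt_le_trans xz zx); rewrite ltxx.
Qed.

Lemma covered_by_chain C x y z : maximal_chain C -> x \in C -> y \in C ->
  z \in C -> covered_by x y -> (z <= x) || (y <= z).
Proof.
move=> CC xC yC zC /covered_byP[xy H].
case/orP: (maximal_chain_cmp CC zC xC) => [->//|].
rewrite le_eqVlt => /orP[/eqP ->|xz]; first by rewrite lexx.
case/orP: (maximal_chain_cmp CC zC yC) => [zy|->]; last by rewrite orbT.
by rewrite (H z xz zy) lexx orbT.
Qed.

End MaximalChains.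

(** * Maximal chains drawn as graphs of functions of the height *)

Section ChainLines.
Local Open Scope ring_scope.
Variables (R : realType) (d : Order.disp_t) (L : finTBLatticeType d).
Variable pos : L -> R * R.
Local Notation ht x := (pos x).2.
Local Notation xc x := (pos x).1.
Implicit Types (a b x y z : L) (C : {set L}) (s t : R) (p q : R * R).

(** Linear interpolation: the abscissa at height [s] of the full line through the points of [a] and
    [b]. *)
Definition edge_x a b s : R := xc a + (s - ht a) / (ht b - ht a) * (xc b - xc a).

(* The last vertex has no edge above it: at its height, and at heights off the
   diagram, the value is the abscissa of the top element. *)
Definition chain_x C s : R :=
  if [pick ab : L * L | [&& ab.1 \in C, ab.2 \in C, covered_by ab.1 ab.2
        & ht ab.1 <= s < ht ab.2]] is Some ab
  then edge_x ab.1 ab.2 s else xc \top%O.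

Lemma edge_x_affine a b s t k :
  edge_x a b (s + k * (t - s)) =
  edge_x a b s + k * (edge_x a b t - edge_x a b s).
Proof. rewrite /edge_x; ring. Qed.

Lemma edge_x_left a b : edge_x a b (ht a) = xc a.
Proof. by rewrite /edge_x subrr !mul0r addr0. Qed.

Lemma edge_x_right a b : ht a != ht b -> edge_x a b (ht b) = xc b.
Proof. by move=> ab; rewrite /edge_x divff ?mul1r ?subrKC // subr_eq0 eq_sym. Qed.

Hypothesis pos_planar : planar_diagram pos.

Lemma ht_lt x y : (x < y)%O -> ht x < ht y.
Proof. by case: pos_planar => -[_ H _] _; exact: H. Qed.

Lemma ht_le x y : (x <= y)%O -> ht x <= ht y.
Proof. by rewrite le_eqVlt => /orP[/eqP ->//|/ht_lt /ltW]. Qed.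

Lemma ht_chain_le C x y : maximal_chain C -> x \in C -> y \in C ->
  (ht x <= ht y) = (x <= y)%O.
Proof.
move=> CC xC yC; apply/idP/idP; last exact: ht_le.
case/orP: (maximal_chain_cmp CC xC yC) => // yx.
move: yx; rewrite le_eqVlt => /orP[/eqP ->//|/ht_lt yx].
by rewrite leNgt yx.
Qed.

Lemma ht_chain_lt C x y : maximal_chain C -> x \in C -> y \in C ->
  (ht x < ht y) = (x < y)%O.
Proof.
move=> CC xC yC; rewrite ltNge (ht_chain_le CC) // comparable_ltNge //.
exact: maximal_chain_cmp xC yC.
Qed.

(** Heights strictly increase along an edge, so the edge is a graph over its height range; its
    parameter is the relative height. *)
Lemma on_edgeP a b p : (a < b)%O ->
  on_edge pos a b p <-> ht a <= p.2 <= ht b /\ p.1 = edge_x a b p.2.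
Proof.
move=> /ht_lt ab; have ba0 : 0 < ht b - ht a by rewrite subr_gt0.
have nz : ht b - ht a != 0 by rewrite gt_eqF.
split=> [[t /andP[t0 t1] ->]|] /=.
  split; first by apply/andP; split; nra.
  rewrite /edge_x; field; exact: nz.
case: p => u s /= [/andP[as_ sb] ->]; exists ((s - ht a) / (ht b - ht a)).
  by rewrite divr_ge0 ?ler_pdivrMr ?subr_ge0 ?mul1r ?lerB // ltW.
rewrite /edge_x; congr (_, _); last by field; exact: nz.
by ring.
Qed.

(** The highest vertex of [C] not above [s] and the lowest one above [s] are neighbours. *)
Lemma chain_edge C s : maximal_chain C -> ht \bot%O <= s < ht \top%O ->
  exists a b, [/\ a \in C, b \in C, covered_by a b & ht a <= s < ht b].
Proof.
move=> CC /andP[s0 s1].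
have Pa : (\bot%O \in C) && (ht (\bot%O : L) <= s) by rewrite maximal_chain_bot.
have Pb : (\top%O \in C) && (s < ht (\top%O : L)) by rewrite maximal_chain_top.
case: (@arg_maxP _ _ _ _ (fun a => (a \in C) && (ht a <= s)) (fun a => ht a) Pa)
  => a /andP[aC as_] amax.
case: (@arg_minP _ _ _ _ (fun a => (a \in C) && (s < ht a)) (fun a => ht a) Pb)
  => b /andP[bC sb] bmin.
exists a, b; rewrite as_ sb; split=> //.
apply: (chain_covered_by CC aC bC).
  by rewrite -(ht_chain_lt CC) //; exact: le_lt_trans sb.
move=> z zC; rewrite -!(ht_chain_le CC) //.
case: (leP (ht z) s) => zs; apply/orP; [left|right].
  by apply: amax; rewrite zC.
by apply: bmin; rewrite zC.
Qed.

Lemma chain_xE C a b s : maximal_chain C -> a \in C -> b \in C ->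
  covered_by a b -> ht a <= s <= ht b -> chain_x C s = edge_x a b s.
Proof.
move=> CC aC bC ab /andP[as_ sb]; rewrite /chain_x.
case: pickP => [[a' b'] /= /and4P[aC' bC' ab' /andP[as' sb']]|none].
  have abn : ht a != ht b by rewrite lt_eqF // ht_lt // covered_by_lt.
  (* At [s = ht b] the selected edge may be the next one up; both edges then give the abscissa of
     [b]. *)
  have ba' : (b <= a')%O -> edge_x a' b' s = edge_x a b s.
    move=> /ht_le ba; have -> : s = ht a' by apply/le_anti; lra.
    have eab : ht a' = ht b by apply/le_anti; lra.
    have -> : a' = b.
      by apply/le_anti; rewrite -!(ht_chain_le CC) // eab lexx.
    by rewrite edge_x_left edge_x_right.
  have b'a : (b' <= a)%O -> False by move=> /ht_le ?; lra.
  case/orP: (covered_by_chain CC aC bC aC' ab) => [a'a|//].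
  case/orP: (covered_by_chain CC aC' bC' aC ab') => [aa'|/b'a //].
  have ea : a = a' by apply/le_anti; rewrite a'a aa'.
  rewrite -ea in ab' *.
  case/orP: (covered_by_chain CC aC bC bC' ab) => [/b'a //|bb'].
  case/covered_byP: ab' => _ /(_ b (covered_by_lt ab) bb') -> //.
(* No edge was selected, so [s] is the height of the top, where the default value of [chain_x] is
   the right one. *)
have [stop|] := ltP s (ht \top%O).
  have s0 : ht \bot%O <= s by apply: le_trans as_; apply: ht_le; exact: le0x.
  case: (chain_edge CC (s := s)) => [|x [y [xC yC xy xsy]]]; first by rewrite s0.
  by have := none (x, y); rewrite /= xC yC xy xsy.
move=> tops; have topb : ht \top%O <= ht b by exact: le_trans sb.
have eb : b = \top%O.
  apply/le_anti; rewrite lex1 -(ht_chain_le CC) //; exact: maximal_chain_top.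
have -> : s = ht b by apply/le_anti; rewrite sb eb.
rewrite edge_x_right ?eb // -eb lt_eqF //; exact/ht_lt/covered_by_lt.
Qed.

Lemma ht_itv x : ht \bot%O <= ht x <= ht \top%O.
Proof. by rewrite !ht_le ?le0x ?lex1. Qed.

Lemma ht_lt_top x : x != \top%O -> ht x < ht \top%O.
Proof. by move=> x1; apply: ht_lt; rewrite lt_neqAle x1 lex1. Qed.

Lemma chain_x_top C : chain_x C (ht \top%O) = xc \top%O.
Proof.
rewrite /chain_x; case: pickP => // -[a b] /= /and4P[_ _ _ /andP[_]].
by rewrite ltNge; case/andP: (ht_itv b) => _ ->.
Qed.

Lemma chain_edge_at C v : maximal_chain C -> v \in C -> v != \top%O ->
  exists2 w, w \in C & covered_by v w.
Proof.
move=> CC vC v1; case: (chain_edge CC (s := ht v)).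
  by rewrite ht_lt_top // andbT; case/andP: (ht_itv v).
move=> a [b [aC bC ab]]; rewrite (ht_chain_le CC) // (ht_chain_lt CC) //.
case/andP=> av vb; exists b => //; rewrite (_ : v = a) //.
case/orP: (covered_by_chain CC aC bC vC ab) => H; first by apply/le_anti; rewrite av H.
by move: (lt_le_trans vb H); rewrite ltxx.
Qed.

Lemma chain_x_vertex C v : maximal_chain C -> v \in C -> chain_x C (ht v) = xc v.
Proof.
move=> CC vC; have [->|v1] := eqVneq v \top%O; first exact: chain_x_top.
have [w wC vw] := chain_edge_at CC vC v1.
rewrite (chain_xE CC vC wC vw) ?edge_x_left // lexx ltW //.
exact/ht_lt/covered_by_lt.
Qed.

(** In a Hasse diagram an edge passes through no vertex but its endpoints, so a vertex on the line
    of [C] belongs to [C]. *)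
Lemma chain_x_mem C v : maximal_chain C -> chain_x C (ht v) = xc v -> v \in C.
Proof.
move=> CC; have [->|v1] := eqVneq v \top%O; first by rewrite maximal_chain_top.
case: (chain_edge CC (s := ht v)).
  by rewrite ht_lt_top // andbT; case/andP: (ht_itv v).
move=> a [b [aC bC ab /andP[av vb]]].
rewrite (chain_xE CC aC bC ab) ?av ?ltW // => e.
have : on_edge pos a b (pos v).
  by apply/(on_edgeP _ (covered_by_lt ab)); rewrite av ltW.
by case: pos_planar => -[_ _ H] _ /(H _ _ _ ab)[] ->.
Qed.

Lemma on_chain_line_x C p : maximal_chain C -> on_chain_line pos C p ->
  p.1 = chain_x C p.2 /\ ht \bot%O <= p.2 <= ht \top%O.
Proof.
move=> CC [a [b [aC bC ab]]]; move/(on_edgeP _ (covered_by_lt ab)) => [apb ->].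
rewrite (chain_xE CC aC bC ab) //; split=> //.
case/andP: apb => ap pb; case/andP: (ht_itv a) => a0 _; case/andP: (ht_itv b) => _ b1.
by rewrite (le_trans a0 ap) (le_trans pb b1).
Qed.

Lemma on_chain_line_ex C s : maximal_chain C -> ht \bot%O <= s < ht \top%O ->
  on_chain_line pos C (chain_x C s, s).
Proof.
move=> CC /(chain_edge CC)[a [b [aC bC ab /andP[as_ sb]]]].
exists a, b; split=> //; apply/(on_edgeP _ (covered_by_lt ab)) => /=.
by rewrite as_ ltW // (chain_xE CC aC bC ab) // as_ ltW.
Qed.

Lemma on_chain_line_vertex C v : maximal_chain C -> v \in C -> v != \top%O ->
  on_chain_line pos C (pos v).
Proof.
move=> CC vC v1; rewrite (surjective_pairing (pos v)) -(chain_x_vertex CC vC).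
apply: on_chain_line_ex => //; rewrite ht_lt_top // andbT.
by case/andP: (ht_itv v).
Qed.

(* Induction on the number of vertices at heights strictly between [s] and [t];
   when there are none, both lines are single edges, hence affine, there. *)
Lemma chain_lines_cross C C' s t : maximal_chain C -> maximal_chain C' ->
  ht \bot%O <= s -> s <= t -> t < ht \top%O ->
  chain_x C s < chain_x C' s -> chain_x C' t < chain_x C t ->
  exists z, [/\ z \in C, z \in C' & s <= ht z <= t].
Proof.
move=> CC CC'; have [n] := ubnP #|[set v | s < ht v < t]|.
elim: n s t => // n IH s t le_n s0 st t1 lts gtt.
have [v /andP[/andP[sv vt] vCC']|none] :=
    pickP (fun v => (s < ht v < t) && ((v \in C) || (v \in C'))).
  have sub (u w : R) : s <= u -> w <= t -> ~~ (u < ht v < w) ->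
      (#|[set x | (u < ht x < w)%R]| < n)%N.
    move=> su wt vuw; rewrite ltnS in le_n; apply: leq_trans le_n.
    apply: proper_card; apply/properP; split.
      by apply/subsetP => x; rewrite !inE => /andP[ux xw]; lra.
    by exists v; rewrite inE ?sv ?vt.
  (* At the height of [v] the lines either meet, or are ordered so that one of the two halves still
     contains a swap of sides. *)
  have [lt|gt|eq] := ltgtP (chain_x C (ht v)) (chain_x C' (ht v)).
  - case: (IH (ht v) t) => //.
    + by apply: sub; [exact: ltW|exact: lexx|rewrite ltxx].
    + by lra.
    + by rewrite ltW.
    by move=> z [zC zC' /andP[vz zt]]; exists z; split=> //; lra.
  - case: (IH s (ht v)) => //.
    + by apply: sub; [exact: lexx|exact: ltW|rewrite ltxx andbF].
    + by rewrite ltW.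
    + by lra.
    by move=> z [zC zC' /andP[vz zt]]; exists z; split=> //; lra.
  exists v; rewrite !ltW //; case/orP: vCC' => vC; split=> //.
    by apply: (chain_x_mem CC'); rewrite -eq chain_x_vertex.
  by apply: (chain_x_mem CC); rewrite eq chain_x_vertex.
have st' : s < t.
  rewrite lt_neqAle st andbT; apply/eqP => est; move: gtt; rewrite -est; lra.
have edge D : maximal_chain D -> (forall v, v \in D -> (v \in C) || (v \in C')) ->
    exists a b, [/\ a \in D, b \in D, covered_by a b, ht a <= s & t <= ht b].
  move=> DD sub; case: (chain_edge DD (s := s)) => [|a [b [aD bD ab /andP[as_ sb]]]].
    by rewrite s0 (lt_trans st').
  exists a, b; split=> //; have := none b; rewrite sub // andbT sb /=.
  by move/negbT; rewrite -leNgt.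
have [a [b [aC bC ab as_ tb]]] := edge C CC (fun v vC => introT orP (or_introl vC)).
have [a' [b' [aC' bC' ab' as' tb']]] :=
  edge C' CC' (fun v vC => introT orP (or_intror vC)).
have Ex u : s <= u <= t -> chain_x C u = edge_x a b u.
  by move=> /andP[su ut]; apply: chain_xE => //; lra.
have Ex' u : s <= u <= t -> chain_x C' u = edge_x a' b' u.
  by move=> /andP[su ut]; apply: chain_xE => //; lra.
rewrite !(Ex, Ex') ?lexx ?st // in lts gtt.
have ne : (a, b) <> (a', b').
  by case=> ea eb; move: lts; rewrite ea eb ltxx.
(* The gaps at both ends are positive; the affine difference of the two edges vanishes at the
   fraction [k] of the way from [s] to [t]. *)
pose gs := edge_x a' b' s - edge_x a b s; pose gt := edge_x a b t - edge_x a' b' t.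
have gs0 : 0 < gs by rewrite subr_gt0.
have gst0 : gs < gs + gt by rewrite ltrDl subr_gt0.
have gst : 0 < gs + gt := lt_trans gs0 gst0.
pose k := gs / (gs + gt).
have k0 : 0 < k by exact: divr_gt0.
have k1 : k < 1 by rewrite ltr_pdivrMr // mul1r.
pose u := s + k * (t - s).
have ust : s <= u <= t.
  have := mulr_gt0 k0 (_ : 0 < t - s); rewrite subr_gt0 => /(_ st') k_st.
  have := mulr_gt0 (_ : 0 < 1 - k) (_ : 0 < t - s); rewrite !subr_gt0.
  move=> /(_ k1 st'); rewrite /u; clearbody k; lra.
have eu : edge_x a b u = edge_x a' b' u.
  rewrite /u !edge_x_affine /k; move: (gt_eqF gst); rewrite /gs /gt => nz.
  by field; rewrite nz.
have on1 : on_edge pos a b (edge_x a b u, u).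
  by apply/(on_edgeP _ (covered_by_lt ab)); split=> //=; lra.
have on2 : on_edge pos a' b' (edge_x a b u, u).
  by apply/(on_edgeP _ (covered_by_lt ab')); split=> //=; lra.
case: pos_planar => _ /(_ _ _ _ _ _ ab ab' ne on1 on2)[v [vab vab' ev]].
exists v; split; first by case: vab => ->.
  by case: vab' => ->.
by rewrite -ev.
Qed.

End ChainLines.

(** * The leftmost dual atom and the left boundary *)

Section LeftmostDualAtom.
Local Open Scope ring_scope.
Variables (R : realType) (d : Order.disp_t) (L : finTBLatticeType d).
Variable pos : L -> R * R.
Local Notation ht x := (pos x).2.
Local Notation xc x := (pos x).1.
Implicit Types (a b e x y z : L) (C : {set L}) (s t : R) (p q : R * R).

(* From height [t] upwards every maximal chain is drawn as its last edge alone,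
   so comparing last edges at [t] compares whole chains near the top. *)
Definition leftmost_dual_atom_at t e : Prop :=
  [/\ dual_atom e, t < ht \top%O, forall x, x != \top%O -> ht x <= t
    & forall e', dual_atom e' -> e' != e ->
        edge_x pos e \top%O t < edge_x pos e' \top%O t].

Hypothesis pos_planar : planar_diagram pos.

Lemma leftmost_dual_atom_exists : (1 < #|L|)%N ->
  exists t e, leftmost_dual_atom_at t e.
Proof.
move=> L1; have bt : (\bot < \top :> L)%O.
  rewrite lt_neqAle le0x andbT; apply: contraTneq L1 => bt.
  have z0 z : z = \bot%O by apply/le_anti; rewrite le0x bt lex1.
  by rewrite -leqNgt; apply/card_le1P => x _ y; rewrite !inE (z0 x) (z0 y) eqxx.
have b1 : (\bot : L)%O != \top%O by rewrite lt_eqF.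
(* The height [t] is that of a highest vertex [m] other than the top; [e] then minimizes the
   abscissa of the last edge at this height. *)
case: (@arg_maxP _ _ _ _ (fun x => x != \top%O) (fun x => ht x) b1) => m m1 maxm.
have [C [CC _ _]] := maximal_chain_through (lexx (\bot%O : L)).
have [|e0 [b [_ _ e0b]]] := chain_edge pos_planar CC (s := ht m).
  by rewrite (ht_lt_top pos_planar) // andbT; case/andP: (ht_itv pos_planar m).
move=> /andP[_ mb]; have eb : b = \top%O.
  by apply: contraTeq mb => bn; rewrite -leNgt; exact: maxm.
rewrite eb in e0b.
case: (@arg_minP _ _ _ _ (fun x => dual_atom x)
  (fun x => edge_x pos x \top%O (ht m)) e0b) => e De mine.
exists (ht m), e; split=> //.
  exact: (ht_lt_top pos_planar).
move=> e' De' ne; rewrite lt_neqAle mine // andbT.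
(* A tie would make two distinct last edges meet below the top, at a vertex common to both, which is
   impossible. *)
apply/eqP => eq.
have on f : dual_atom f -> on_edge pos f \top%O (edge_x pos f \top%O (ht m), ht m).
  move=> Df; apply/(on_edgeP pos_planar _ (covered_by_lt Df)); split=> //=.
  rewrite (ltW (ht_lt_top pos_planar m1)) andbT; apply: maxm.
  exact: dual_atom_neq_top.
have on1 := on _ De; have on2 := on _ De'; rewrite -eq in on2.
case: pos_planar => _ /(_ _ _ _ _ _ De De' _ on1 on2)[].
  by case=> ee; rewrite ee eqxx in ne.
have htm : ht m < ht \top%O by exact: (ht_lt_top pos_planar).
move=> v [ve ve' /(congr1 snd) /= em].
case: ve em ve' => -> em; last by rewrite em ltxx in htm.
case=> ee; first by rewrite ee eqxx in ne.
by rewrite em ee ltxx in htm.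
Qed.

Section Leftmost.
Variables (t : R) (e : L).
Hypothesis leftmost_e : leftmost_dual_atom_at t e.

Let dual_e : dual_atom e. Proof. by case: leftmost_e. Qed.
Let t_top : t < ht \top%O. Proof. by case: leftmost_e. Qed.
Let ht_t x : x != \top%O -> ht x <= t.
Proof. by case: leftmost_e => _ _ + _; exact. Qed.

Let top_e : ~~ (\top <= e)%O.
Proof. by rewrite (lt_geF (covered_by_lt dual_e)). Qed.

Lemma le_leftmost C z : maximal_chain C -> e \in C -> z \in C -> ht z <= t ->
  (z <= e)%O.
Proof.
move=> CC eC zC zt; case/orP: (maximal_chain_cmp CC zC eC) => // ez.
case: (dual_atom_le dual_e ez) => [->//|z1]; rewrite z1 in zt.
by move: (le_lt_trans zt t_top); rewrite ltxx.
Qed.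

(** Above [t] both lines are last edges, and their gap shrinks linearly from a positive value at [t]
    to zero at the top. *)
Lemma leftmost_left_of C C' : maximal_chain C -> e \in C ->
  maximal_chain C' -> e \notin C' ->
  forall s, t <= s < ht \top%O -> chain_x pos C s < chain_x pos C' s.
Proof.
move=> CC eC CC' eC' s /andP[ts s1].
have b0 : ht \bot%O <= t.
  by apply: ht_t; rewrite lt_eqF // (le_lt_trans (le0x e)) // covered_by_lt.
have [|e' [b [eC'' bC' e'b]]] := chain_edge pos_planar CC' (s := t).
  by rewrite b0.
move=> /andP[e't tb]; have eb : b = \top%O.
  by apply: contraTeq tb => bn; rewrite -leNgt; exact: ht_t.
rewrite eb in e'b bC'.
have ne : e' != e by apply: contraNneq eC' => <-.
case: leftmost_e => _ _ _ /(_ e' e'b ne) lt.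
have et : ht e <= t by apply: ht_t; exact: dual_atom_neq_top.
rewrite (chain_xE pos_planar CC eC (maximal_chain_top CC) dual_e); last first.
  by rewrite (le_trans et ts) ltW.
rewrite (chain_xE pos_planar CC' eC'' bC' e'b); last first.
  by rewrite (le_trans e't ts) ltW.
pose k := (s - t) / (ht \top%O - t).
have k0 : 0 <= k by rewrite divr_ge0 // subr_ge0 // ltW.
have k1 : k < 1 by rewrite ltr_pdivrMr ?subr_gt0 // mul1r ltrD2r.
have es : s = t + k * (ht \top%O - t).
  by rewrite /k divfK ?subrKC // subr_eq0 gt_eqF.
rewrite es !edge_x_affine !edge_x_right; first by clearbody k; nra.
  by rewrite lt_eqF //; exact/(ht_lt pos_planar)/covered_by_lt.
by rewrite lt_eqF //; exact/(ht_lt pos_planar)/covered_by_lt.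
Qed.

(** Otherwise a maximal chain through [y] and [x], where [y] is the meet, starts left of [C] at [y].
    It avoids [e], so it is right of [C] at [t] and meets [C] at some [z] between [y] and [e]. If
    [z] is below [x], then [z = y] lies on [C]; if above, then [x] is below [e]. *)
Lemma meet_leftmost_not_left C x : ~~ (x <= e)%O ->
  maximal_chain C -> e \in C ->
  chain_x pos C (ht (x `&` e)%O) <= xc (x `&` e)%O.
Proof.
move=> xe CC eC; set y := (x `&` e)%O; rewrite leNgt; apply/negP => lt.
have yC : y \notin C.
  by apply: contraTN lt => yC; rewrite (chain_x_vertex pos_planar) // ltxx.
have ye : (y <= e)%O by exact: leIr.
have [C' [CC' yC' xC']] := maximal_chain_through (leIl x e : (y <= x)%O).
have eC' : e \notin C'.
  apply/negP => /(maximal_chain_cmp CC' xC')/orP[xe'|]; first by rewrite xe' in xe.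
  move=> /(dual_atom_le dual_e)[x_e|x1]; first by rewrite x_e lexx in xe.
  by move: yC; rewrite /y x1 meet1x eC.
have yt : ht y <= t.
  apply: ht_t; apply: contraTneq ye => ->; exact: top_e.
have ltt := leftmost_left_of CC eC CC' eC' (s := t).
rewrite lexx t_top in ltt.
rewrite -(chain_x_vertex pos_planar CC' yC') in lt.
have [|z [zC' zC /andP[yz zt]]] :=
    chain_lines_cross pos_planar CC' CC _ yt t_top lt (ltt isT).
  by case/andP: (ht_itv pos_planar y).
have ze := le_leftmost CC eC zC zt.
rewrite (ht_chain_le pos_planar CC') // in yz.
have zy : z = y.
  case/orP: (maximal_chain_cmp CC' zC' xC') => [zx|xz].
    by apply/le_anti; rewrite yz lexI zx ze.
  by rewrite (le_trans xz ze) in xe.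
by rewrite -zy zC in yC.
Qed.

(** If the meets [y] and [y'] were incomparable, each would lie strictly right of a maximal chain
    through [e] and the other one. These two chains then swap sides between the two heights, and
    their crossing vertex lies between [y] and [y'] in the order. *)
Lemma meet_leftmost_chain x x' : ~~ (x <= e)%O -> ~~ (x' <= e)%O ->
  ((x `&` e) >=< (x' `&` e))%O.
Proof.
move=> xe xe'; apply/negP => /negP inc.
have ye : ((x `&` e) <= e)%O by exact: leIr.
have ye' : ((x' `&` e) <= e)%O by exact: leIr.
have [C [CC yC eC]] := maximal_chain_through ye.
have [C' [CC' yC' eC']] := maximal_chain_through ye'.
have := meet_leftmost_not_left xe CC' eC'.
have := meet_leftmost_not_left xe' CC eC.
move: (x `&` e)%O (x' `&` e)%O ye ye' inc yC yC'.
move=> {x x' xe xe'} y y' ye ye' inc yC yC'.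
rewrite !le_eqVlt => /orP[/eqP/(chain_x_mem pos_planar CC) y'C|lt'].
  by case/negP: inc; exact: maximal_chain_cmp y'C.
move=> /orP[/eqP/(chain_x_mem pos_planar CC') y'C|lt].
  by case/negP: inc; exact: maximal_chain_cmp yC'.
have e1 := dual_atom_neq_top dual_e.
have top z : (z <= e)%O -> ht z < ht \top%O.
  by move=> /(ht_le pos_planar) /le_lt_trans; apply; exact: ht_lt_top.
rewrite -(chain_x_vertex pos_planar CC yC) in lt.
rewrite -(chain_x_vertex pos_planar CC' yC') in lt'.
case/negP: inc; case: (leP (ht y) (ht y')) => [yy'|/ltW yy'].
  have [|z [zC' zC /andP[yz zy']]] :=
    chain_lines_cross pos_planar CC' CC _ yy' (top _ ye') lt lt'.
    by case/andP: (ht_itv pos_planar y).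
  rewrite (ht_chain_le pos_planar CC) // in yz.
  rewrite (ht_chain_le pos_planar CC') // in zy'.
  by rewrite /Order.comparable (le_trans yz zy').
have [|z [zC zC' /andP[yz zy']]] :=
  chain_lines_cross pos_planar CC CC' _ yy' (top _ ye) lt' lt.
  by case/andP: (ht_itv pos_planar y').
rewrite (ht_chain_le pos_planar CC') // in yz.
rewrite (ht_chain_le pos_planar CC) // in zy'.
by rewrite /Order.comparable (le_trans yz zy') orbT.
Qed.

Hypothesis L_semimodular : semimodular L.

Lemma leftmost_interval_chain b x0 : covered_by b x0 -> (x0 `&` e)%O = b ->
  is_chain [set y | (b <= y <= e)%O].
Proof.
move=> bx0 x0b.
have x0e : ~~ (x0 <= e)%O.
  by apply: contraTN (covered_by_lt bx0) => /meet_idPl x0e; rewrite -x0b x0e ltxx.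
(* By semimodularity [y] is covered by its join with [x0], so meeting that join with [e] returns
   [y], or else [x0] would be below [e]. *)
have ey y : (b <= y <= e)%O -> ((x0 `|` y) `&` e = y)%O.
  move=> /andP[by_ ye]; have x0y : (x0 `&` y = b)%O.
    apply/le_anti; rewrite lexI (ltW (covered_by_lt bx0)) by_ andbT.
    by rewrite -x0b lexI leIl (le_trans (leIr _ _) ye).
  have /covered_byP[_ cov] : covered_by y (x0 `|` y)%O.
    by apply: L_semimodular; rewrite x0y.
  have ym : (y <= (x0 `|` y) `&` e)%O by rewrite lexI leUr ye.
  move: (ym); rewrite le_eqVlt.
  case/orP => [/eqP <-//|/cov /(_ (leIl _ _)) em].
  by case/negP: x0e; apply: le_trans (leUl _ y) _; rewrite -em leIr.
apply: chainP => y z; rewrite !inE => yI zI.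
rewrite -(ey y yI) -(ey z zI); apply: meet_leftmost_chain.
  by apply: contraNN x0e; apply: le_trans (leUl _ _).
by apply: contraNN x0e; apply: le_trans (leUl _ _).
Qed.

Hypothesis indecomposable : forall b a : L, ~~ chain_decomposition b a.

(** The meets with [e] of the elements not below [e] form a chain, so one of minimal height is their
    least element [b]. Every element is below [e] or above [b], and indecomposability forces [b] to
    be the bottom. *)
Lemma leftmost_complemented :
  exists2 x0, covered_by \bot%O x0 & (x0 `&` e)%O = \bot%O.
Proof.
case: (@arg_minP _ _ _ _ (fun x => ~~ (x <= e)%O) (fun x => ht (x `&` e)%O) top_e).
move=> x xe minx; set b := (x `&` e)%O.
have be : (b <= e)%O by exact: leIr.
have bx : (b < x)%O by rewrite lt_neqAle leIl andbT; apply: contraNneq xe => <-.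
have [x0 bx0 x0x] := covered_by_exists bx.
have bmin y : ~~ (y <= e)%O -> (b <= y)%O.
  move=> ye; apply: le_trans (leIl y e).
  case/orP: (meet_leftmost_chain xe ye) => //.
  rewrite le_eqVlt => /orP[/eqP ->//|/(ht_lt pos_planar)].
  by rewrite ltNge minx.
have x0e : ~~ (x0 <= e)%O.
  by apply: contraTN (covered_by_lt bx0) => x0e; rewrite le_gtF // lexI x0x x0e.
have x0b : (x0 `&` e)%O = b.
  apply/le_anti/andP; split; last by rewrite lexI be ltW // covered_by_lt.
  by rewrite lexI (le_trans (leIl _ _) x0x) leIr.
have [b0|bn0] := eqVneq b \bot%O; first by exists x0; rewrite -?b0.
case/negP: (indecomposable b e); apply/and5P; split=> //.
- exact: dual_atom_neq_top.
- by apply/forallP => y; case: (boolP (y <= e)%O) => //= /bmin.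
exact: leftmost_interval_chain x0b.
Qed.

Definition leftmost_chain : {set L} := [set y | (y <= e)%O || (y == \top%O)].

Lemma leftmost_below_chain : is_chain [set y | (y <= e)%O].
Proof.
have [x0 x0_atom x0e] := leftmost_complemented.
apply: chainP => y z; rewrite !inE => ye ze.
by apply: (chain_cmp (leftmost_interval_chain x0_atom x0e)); rewrite inE le0x.
Qed.

Lemma leftmost_chain_sub C : maximal_chain C -> e \in C -> C \subset leftmost_chain.
Proof.
move=> CC eC; apply/subsetP => z zC; rewrite inE.
case/orP: (maximal_chain_cmp CC zC eC) => [->//|/(dual_atom_le dual_e)[->|->]].
  by rewrite lexx.
by rewrite eqxx orbT.
Qed.

(** Any maximal chain extending this one contains [e], hence lies inside it because [e] is a dual
    atom. *)
Lemma maximal_leftmost_chain : maximal_chain leftmost_chain.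
Proof.
have chain : is_chain leftmost_chain.
  apply: chainP => y z; rewrite !inE.
  case/orP => [ye|/eqP ->]; last by rewrite /Order.comparable lex1 orbT.
  case/orP => [ze|/eqP ->]; last by rewrite /Order.comparable lex1.
  by apply: (chain_cmp leftmost_below_chain); rewrite inE.
have [C CC /subsetP sub] := maxset_exists chain.
have eC : e \in C by apply: sub; rewrite inE lexx.
rewrite (_ : leftmost_chain = C) //; apply/eqP; rewrite eqEsubset.
by rewrite (leftmost_chain_sub CC eC) andbT; apply/subsetP.
Qed.

(** If [C] were further left at some height below [t], it would meet the leftmost chain at a vertex
    [z] below [e]. Everything of [C] under [z] is then in the leftmost chain, so the two lines agree
    at that height. *)
Lemma leftmost_chain_x_le C s : maximal_chain C ->
  ht \bot%O <= s <= ht \top%O -> chain_x pos leftmost_chain s <= chain_x pos C s.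
Proof.
move=> CC /andP[s0]; rewrite le_eqVlt => /orP[/eqP ->|s1].
  by rewrite !chain_x_top.
have MC := maximal_leftmost_chain.
have eM : e \in leftmost_chain by rewrite inE lexx.
have [eC|eC] := boolP (e \in C).
  by rewrite (maximal_chain_eq MC CC (leftmost_chain_sub CC eC)).
have left := leftmost_left_of MC eM CC eC.
have [ts|st] := leP t s; first by apply/ltW/left; rewrite ts.
have ltt : chain_x pos leftmost_chain t < chain_x pos C t.
  by apply: left; rewrite lexx.
rewrite leNgt; apply/negP => lt.
have [z [zC zM /andP[]]] :=
  chain_lines_cross pos_planar CC MC s0 (ltW st) t_top lt ltt.
rewrite le_eqVlt => /orP[/eqP sz|sz] zt.
  by move: lt; rewrite sz !chain_x_vertex // ltxx.
(* The edge of [C] at height [s] ends at or below [z], so it is also an edge of the leftmost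
   chain. *)
have [|a [b [aC bC ab /andP[as_ sb]]]] := chain_edge pos_planar CC (s := s).
  by rewrite s0.
have bz : (b <= z)%O.
  case/orP: (covered_by_chain CC aC bC zC ab) => // /(ht_le pos_planar) za.
  by move: (lt_le_trans sz (le_trans za as_)); rewrite ltxx.
have be : (b <= e)%O by apply: le_trans bz (le_leftmost MC eM zM zt).
have bM : b \in leftmost_chain by rewrite inE be.
have aM : a \in leftmost_chain.
  by rewrite inE (le_trans (ltW (covered_by_lt ab)) be).
have sab : ht a <= s <= ht b by rewrite as_ ltW.
by move: lt; rewrite !(chain_xE pos_planar _ _ _ ab sab) // ltxx.
Qed.

Lemma left_boundary_leftmost_chain : left_boundary pos leftmost_chain.
Proof.
split; first exact: maximal_leftmost_chain.
move=> C p q CC /(on_chain_line_x pos_planar maximal_leftmost_chain)[-> s_itv].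
move=> /(on_chain_line_x pos_planar CC)[-> _] <-.
exact: leftmost_chain_x_le.
Qed.

(** Join-irreducibility holds because the elements below [e] form a chain, meet-irreducibility
    because [e] is a dual atom. *)
Lemma leftmost_doubly_irreducible : e != \bot%O -> doubly_irreducible e.
Proof.
move=> e0; split; split; try exact/eqP; [|exact/eqP/dual_atom_neq_top|].
  move=> a b eab.
  have ae : (a <= e)%O by rewrite eab leUl.
  have be : (b <= e)%O by rewrite eab leUr.
  have /orP[/join_idPl ab|/join_idPr ab] : (a >=< b)%O.
    by apply: (chain_cmp leftmost_below_chain); rewrite inE.
  - by right; rewrite {1}eab joinC ab.
  - by left; rewrite {1}eab joinC ab.
move=> a b eab.
have ea : (e <= a)%O by rewrite eab leIl.
have eb : (e <= b)%O by rewrite eab leIr.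
case: (dual_atom_le dual_e ea) => [->|a1]; first by left.
case: (dual_atom_le dual_e eb) => [->|b1]; first by right.
by move: (dual_atom_neq_top dual_e); rewrite eab a1 b1 meetxx eqxx.
Qed.

Lemma left_weak_corner_leftmost : e != \bot%O ->
  forall u, left_weak_corner pos u <-> u = e.
Proof.
move=> e0 u; split=> [[u0 u1 [_ [_ u_meet]] [C [CC left] uC]]|->]; last first.
  split; [exact/eqP|exact/eqP/dual_atom_neq_top|exact: leftmost_doubly_irreducible|].
  by exists leftmost_chain; [exact: left_boundary_leftmost_chain|rewrite inE lexx].
have MC := maximal_leftmost_chain.
(* Two left boundaries have the same abscissa at every height below the top, so [u] lies on the
   leftmost chain too. *)
have uM : u \in leftmost_chain.
  move/eqP: u1 => u1; apply: (chain_x_mem pos_planar MC); apply/le_anti/andP; split.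
    rewrite -(chain_x_vertex pos_planar CC uC).
    exact: leftmost_chain_x_le (ht_itv pos_planar u).
  have onM : on_chain_line pos leftmost_chain (chain_x pos leftmost_chain (ht u), ht u).
    apply: (on_chain_line_ex pos_planar MC).
    by rewrite (ht_lt_top pos_planar) // andbT; case/andP: (ht_itv pos_planar u).
  exact: left (on_chain_line_vertex pos_planar CC uC u1) onM erefl.
move: uM; rewrite inE => /orP[|/eqP //]; rewrite le_eqVlt => /orP[/eqP //|ue].
have [x0 /covered_byP[x0_gt x0_cov] x0e] := leftmost_complemented.
have [u' /covered_by_lt uu' u'e] := covered_by_exists ue.
have ux0 : (x0 `&` u = \bot)%O.
  by apply/le_anti; rewrite le0x andbT -x0e lexI leIl (le_trans (leIr _ _) (ltW ue)).
have /covered_byP[ux0_lt cov] : covered_by u (x0 `|` u)%O.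
  by apply: L_semimodular; rewrite ux0; apply/covered_byP.
(* An element [u] strictly below [e] has the upper covers [u'], which is below [e], and its join
   with [x0], which is not; it is their meet, hence meet-reducible. *)
case: (u_meet u' (x0 `|` u)%O) => [|uu|uu].
- have : (u <= u' `&` (x0 `|` u))%O by rewrite lexI (ltW uu') (ltW ux0_lt).
  rewrite le_eqVlt => /orP[/eqP //|/cov /(_ (leIr _ _)) em].
  have x0u' : (x0 <= u')%O.
    by apply: le_trans (leUl _ u) _; rewrite -em leIl.
  move: x0_gt; rewrite -x0e lt_neqAle leIl andbT (meet_idPl _) ?eqxx //.
  exact: le_trans x0u' u'e.
- by rewrite -uu ltxx in uu'.
- by rewrite -uu ltxx in ux0_lt.
Qed.

End Leftmost.
End LeftmostDualAtom.

(** * Reflection of diagrams, exchanging left and right *)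

Section Mirror.
Local Open Scope ring_scope.
Variables (R : realType) (d : Order.disp_t) (L : finTBLatticeType d).
Variable pos : L -> R * R.
Implicit Types (p q : R * R) (C : {set L}).

Definition mirror_point p : R * R := (- p.1, p.2).
Definition mirror (x : L) : R * R := mirror_point (pos x).

Lemma mirror_pointK : involutive mirror_point.
Proof. by case=> u s; rewrite /mirror_point /= opprK. Qed.

Lemma on_edge_mirror a b p : on_edge mirror a b p -> on_edge pos a b (mirror_point p).
Proof.
case=> k k01 ->; exists k => //; rewrite /mirror_point /=; congr (_, _); ring.
Qed.

Lemma on_edge_mirrorV a b p : on_edge pos a b p -> on_edge mirror a b (mirror_point p).
Proof.
case=> k k01 ->; exists k => //; rewrite /mirror_point /=; congr (_, _); ring.
Qed.

Lemma on_chain_line_mirror C p :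
  on_chain_line mirror C p <-> on_chain_line pos C (mirror_point p).
Proof.
split=> -[a [b [aC bC ab ed]]]; exists a, b; split=> //.
  exact: on_edge_mirror.
by rewrite -(mirror_pointK p); apply: on_edge_mirrorV.
Qed.

Lemma mirror_planar : planar_diagram pos -> planar_diagram mirror.
Proof.
case=> -[pos_inj pos_lt pos_edge] pos_cross; split; first split.
- exact: inj_comp (can_inj mirror_pointK) pos_inj.
- exact: pos_lt.
- move=> a b c ab /on_edge_mirror; rewrite mirror_pointK; exact: pos_edge.
move=> a b a' b' p ab ab' ne /on_edge_mirror e1 /on_edge_mirror e2.
have [v [v1 v2 ev]] := pos_cross _ _ _ _ _ ab ab' ne e1 e2.
by exists v; split; rewrite // -(mirror_pointK p) ev.
Qed.

Lemma right_boundary_mirror C : right_boundary pos C <-> left_boundary mirror C.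
Proof.
split=> -[CC H]; split=> // C' p q CC'.
  move=> /on_chain_line_mirror p1 /on_chain_line_mirror q1 pq.
  by have := H _ _ _ CC' p1 q1 pq; rewrite lerN2.
rewrite -{1}(mirror_pointK p) -{1}(mirror_pointK q).
move=> /on_chain_line_mirror p1 /on_chain_line_mirror q1 pq.
by have := H _ _ _ CC' p1 q1 pq; rewrite lerN2.
Qed.

Lemma right_weak_corner_mirror u :
  right_weak_corner pos u <-> left_weak_corner mirror u.
Proof.
split=> -[u0 u1 irr [C bC uC]]; split=> //; exists C => //;
  exact/right_boundary_mirror.
Qed.

(** At the height of [w] every maximal chain is squeezed between the two boundaries, hence passes
    through [w]; this applies to one through [x]. *)
Lemma boundary_meet_comparable C D w x : planar_diagram pos ->
  left_boundary pos C -> right_boundary pos D -> w \in C -> w \in D ->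
  (w >=< x)%O.
Proof.
move=> planar [CC left] [DD right] wC wD.
have [->|w1] := eqVneq w \top%O; first by rewrite /Order.comparable lex1 orbT.
have [C' [CC' _ xC']] := maximal_chain_through (lexx x).
have on' : on_chain_line pos C' (chain_x pos C' (pos w).2, (pos w).2).
  apply: (on_chain_line_ex planar CC').
  by rewrite (ht_lt_top planar) // andbT; case/andP: (ht_itv planar w).
have onC := on_chain_line_vertex planar CC wC w1.
have onD := on_chain_line_vertex planar DD wD w1.
apply: (maximal_chain_cmp CC') => //; apply: (chain_x_mem planar CC').
apply/le_anti; rewrite (left _ _ _ CC' onC on' erefl) andbT.
exact: (right _ _ _ CC' onD on' erefl).
Qed.

End Mirror.

(** * Indecomposable lattices are patch lattices *)

Section Patch.
Local Open Scope order_scope.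
Variables (R : realType) (d : Order.disp_t) (L : finTBLatticeType d).

Lemma indecomposable_patch : planar R L -> semimodular L -> (1 < #|L|)%N ->
  (forall b a : L, ~~ chain_decomposition b a) -> patch_lattice R L.
Proof.
move=> [pos pos_planar] sm L1 indec.
have mir_planar := mirror_planar pos_planar.
have [t [e left_e]] := leftmost_dual_atom_exists pos_planar L1.
have [t' [e' right_e]] := leftmost_dual_atom_exists mir_planar L1.
have De : dual_atom e by case: left_e.
have De' : dual_atom e' by case: right_e.
(* If the top covers the bottom the lattice has two elements; otherwise no dual atom is the
   bottom. *)
have [covL|ncov] := boolP (covered_by (\bot : L) \top).
  right; have -> : #|L| = #|[set (\bot : L); \top]|.
    rewrite -cardsT; apply: eq_card => x; rewrite !inE.
    have [x0|x0] := eqVneq x \bot => //=; apply/esym/eqP.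
    case/covered_byP: covL => _; apply; last exact: lex1.
    by rewrite lt_neqAle eq_sym x0 le0x.
  by rewrite cards2 lt_eqF // covered_by_lt.
have e0 : e != \bot by apply: contraNneq ncov => <-.
have e'0 : e' != \bot by apply: contraNneq ncov => <-.
have w0 : e `&` e' = \bot.
  apply/eqP; apply: contraT => wn0.
  have cmp x : (e `&` e') >=< x.
    apply: (boundary_meet_comparable _ pos_planar (C := leftmost_chain e)
      (D := leftmost_chain e')).
    - exact: (left_boundary_leftmost_chain pos_planar left_e).
    - apply/right_boundary_mirror.
      exact: (left_boundary_leftmost_chain mir_planar right_e).
    - by rewrite inE leIl.
    - by rewrite inE leIr.
  (* A nonzero meet, being comparable to everything, would split the lattice over a one-element
     chain. *)
  case/negP: (indec (e `&` e') (e `&` e')); apply/and5P; split=> //.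
  - apply: contraNneq (dual_atom_neq_top De) => w1.
    by rewrite -le1x -w1 leIl.
  - by apply/forallP => x; rewrite orbC; exact: cmp.
  - apply: chainP => x y; rewrite !inE => /le_anti <- /le_anti <-.
    exact: comparablexx.
left; exists pos, e, e'; split=> //; split=> //.
- exact: (left_weak_corner_leftmost pos_planar left_e).
- move=> u; rewrite right_weak_corner_mirror.
  exact: (left_weak_corner_leftmost mir_planar right_e).
(* If the join were [e], then [e'] would be below [e] and equal to the meet, which is the bottom. *)
split=> //; case: (dual_atom_le De (leUl e e')) => // ee'.
by move: e'0; rewrite -w0 (meet_idPr _) ?eqxx // -ee' leUr.
Qed.

End Patch.

(** * Concatenation of gluing sequences *)

Section GluingSequence.
Variables (R : realType) (d : Order.disp_t).
Implicit Types (L A B : finTBLatticeType d) (Ls : nat -> finTBLatticeType d).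

Definition gluing_sequence n Ls : Prop :=
  forall i : nat, 1 <= i <= n ->
    patch_lattice R (Ls i) \/
    exists j k : nat,
      [/\ 1 <= j < i, 1 <= k < i & gluing_over_chain (Ls i) (Ls j) (Ls k)].

(** The second sequence is shifted by [m], together with its back references, and [L] is appended as
    the gluing of entries [m] and [m + n]. *)
Lemma gluing_sequence_glue L A B m n As Bs : 1 <= m -> 1 <= n ->
  As m = A -> Bs n = B -> gluing_sequence m As -> gluing_sequence n Bs ->
  gluing_over_chain L A B ->
  gluing_sequence (m + n).+1
    (fun i => if i <= m then As i else if i <= m + n then Bs (i - m) else L).
Proof.
move=> m1 n1 Am Bn seqA seqB glue i /andP[i1 i_le].
have above l : 1 <= l -> (m + l <= m) = false.
  by move=> l1; rewrite leqNgt -[X in X < _]addn0 ltn_add2l l1.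
case: (leqP i m) => im.
  case: (seqA i) => [|?|[j [k [/andP[j1 ji] /andP[k1 ki] jk]]]]; first by rewrite i1.
    by left.
  right; exists j, k; rewrite j1 k1 ji ki; split=> //.
  by rewrite !ifT // ltnW // (leq_trans _ im).
case: (leqP i (m + n)) => imn.
  case: (seqB (i - m)) => [|?|[j [k [/andP[j1 ji] /andP[k1 ki] jk]]]].
  - by rewrite subn_gt0 im leq_subLR.
  - by left.
  right; exists (m + j), (m + k); rewrite -!ltn_subRL ji ki !addn_gt0 m1.
  have bnd l : l < i - m -> m + l <= m + n.
    by move=> li; rewrite leq_add2l; apply: leq_trans (ltnW li) _; rewrite leq_subLR.
  by split=> //; rewrite !(bnd _ ji, bnd _ ki) !addKn !above.
right; exists m, (m + n); rewrite m1 im addn_gt0 m1 imn leqnn; split=> //.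
by rewrite above // addKn Am Bn leqnn.
Qed.

End GluingSequence.

(** * Sizes of intervals, and the induction *)

Section ProperIntervals.
Local Open Scope order_scope.
Variables (d : Order.disp_t) (L : finTBLatticeType d).

Lemma card_interval_gt1 (b a : L) (ba : b <= a) : b != a ->
  (1 < #|{: interval_lattice ba}|)%N.
Proof.
move=> ne; rewrite card_interval; apply/card_gt1P; exists b, a.
by rewrite !inE !lexx ba.
Qed.

Lemma card_interval_lt (b a : L) (ba : b <= a) : (b != \bot) || (a != \top) ->
  (#|{: interval_lattice ba}| < #|L|)%N.
Proof.
rewrite card_interval -cardsT => ne; apply: proper_card; rewrite properT.
case/orP: ne; [rewrite -lex0|rewrite -le1x] => ne.
  by apply: contraNneq ne => /setP /(_ \bot); rewrite !inE => /andP[].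
by apply: contraNneq ne => /setP /(_ \top); rewrite !inE => /andP[].
Qed.

End ProperIntervals.

Theorem mainTheorem1 (R : realType) (d : Order.disp_t)
    (L : finTBLatticeType d) (L_planar : planar R L)
    (L_semimodular : semimodular L) (L_nontrivial : 1 < #|L|) :
  exists (n : nat) (Ls : nat -> finTBLatticeType d),
    [/\ 1 <= n,
        Ls n = L
      & forall i : nat, 1 <= i <= n ->
          patch_lattice R (Ls i) \/
          exists j k : nat,
            [/\ 1 <= j < i, 1 <= k < i
              & gluing_over_chain (Ls i) (Ls j) (Ls k)]].
Proof.
have [N] := ubnP #|L|.
elim: N L L_planar L_semimodular L_nontrivial => // N IH L L_planar L_sm L1 LN.
(* A decomposition yields two smaller intervals. Each still has two elements: [a] is above the
   nonzero [b], and [b] is below [a], which is not the top. *)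
case: (pickP (fun ba : L * L => chain_decomposition ba.1 ba.2)) => [[b a] /= dec|none].
  have [b0 a1 ba _ _] := and5P dec.
  have a0 : (\bot != a)%O.
    by apply: contraNneq b0 => a0; rewrite -lex0 a0.
  have b1 : (b != \top)%O.
    by apply: contraNneq a1 => b1; rewrite -le1x -b1.
  have card_lt (x y : L) (xy : (x <= y)%O) : ((x != \bot) || (y != \top))%O ->
      #|{: interval_lattice xy}| < N.
    by move/(card_interval_lt xy)/leq_trans; apply.
  have [||||m [As [m1 Am seqA]]] := IH (interval_lattice (le0x a)).
  - exact: interval_planar.
  - exact: interval_semimodular.
  - exact: card_interval_gt1.
  - by apply: card_lt; rewrite a1 orbT.
  have [||||n [Bs [n1 Bn seqB]]] := IH (interval_lattice (lex1 b)).
  - exact: interval_planar.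
  - exact: interval_semimodular.
  - exact: card_interval_gt1.
  - by apply: card_lt; rewrite b0.
  have seqL := gluing_sequence_glue m1 n1 Am Bn seqA seqB (decomposition_gluing dec).
  exists (m + n).+1.
  exists (fun i => if i <= m then As i else if i <= m + n then Bs (i - m) else L).
  split=> //; by rewrite !ifF // leqNgt ltnS ?leq_addr ?leqnn.
(* Without a decomposition [L] is itself a patch lattice, and a sequence of length one suffices. *)
exists 1, (fun _ => L); split=> // i _; left.
by apply: indecomposable_patch => // b a; rewrite (none (b, a)).
Qed.
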